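(* Let $d\ge2$, $n\ge3$, and let ancillae $A_1,\dots,A_n$ consecutively measure an unprepared quantum system $Q$ (purified by a reference $R$), so that the joint pure state is $$|\Psi'\rangle=\frac{1}{\sqrt d}\sum_{x_1,\dots,x_n}U^{(2)}_{x_1x_2}\cdots U^{(n)}_{x_{n-1}x_n}\,|\widetilde{x}_n\rangle_Q|x_1\rangle_R|x_1\rangle_{A_1}|x_2\rangle_{A_2}\cdots|x_n\rangle_{A_n}.$$ Let $1\le k<m\le n$ with $m-k\ge2$ (three or more consecutive ancillae). Then the reduced density matrix of $A_k,A_{k+1},\dots,A_m$ (obtained by tracing out $Q$, $R$ and all other ancillae) is a classical-quantum state of the form $$\rho(A_k\cdots A_m)=\frac1d\sum_{x_k,x_m}p_{x_kx_m}\,|x_k\rangle\langle x_k|\otimes|\phi_{x_kx_m}\rangle\langle\phi_{x_kx_m}|\otimes|x_m\rangle\langle x_m|,$$ with $p_{x_kx_m}=\sum_{x_{k+1},\dots,x_{m-1}}|U^{(k+1)}_{x_kx_{k+1}}|^2\cdots|U^{(m)}_{x_{m-1}x_m}|^2$ and $|\phi_{x_kx_m}\rangle$ normalized pure states of $A_{k+1}\cdots A_{m-1}$, and its joint entropy is contained only in the first and last devices of the block: $$S(A_k A_{k+1}\cdots A_{m-1}A_m)=S(A_kA_m).$$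
   Context: $Q$ is a $d$-dimensional system that is ''unprepared'': it is in the maximally mixed state, purified by a reference system $R$ as $|QR\rangle=d^{-1/2}\sum_{x}|\widetilde{x}\rangle|x\rangle$. For each $i$ an orthonormal basis $\{|\widetilde{x}_i\rangle\}_{x_i=1}^d$ of $Q$ is the basis measured by ancilla $A_i$, with $U^{(i)}_{x_{i-1}x_i}=\langle\widetilde{x}_i|\widetilde{x}_{i-1}\rangle$ ($i\ge2$) the entries of a unitary $d\times d$ matrix. Each ancilla $A_i$ is $d$-dimensional with orthonormal basis $\{|x\rangle\}$, starts in a fixed state $|0\rangle$, and measures $Q$ by the unitary $\sum_x|\widetilde{x}_i\rangle\langle\widetilde{x}_i|\otimes U_x$ with $U_x|0\rangle=|x\rangle$, in the order $A_1,A_2,\dots$; writing $R$ in the basis adapted to $A_1$ gives the displayed state. $S$ denotes von Neumann entropy with logarithm base $d$. *)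

(* Defs.v *)
From HB Require Import structures.
From mathcomp Require Import all_boot all_order all_algebra.
From mathcomp Require Import spectral.
From mathcomp Require Import complex.
From mathcomp Require Import all_classical all_reals exp.

Set Implicit Arguments.
Unset Strict Implicit.
Unset Printing Implicit Defensive.

Import Order.TTheory GRing.Theory Num.Theory Num.Def.
Local Open Scope ring_scope.

Section QDefs.
Variable R : realType.
Local Notation C := (R[i]).

(* The ancilla configuration (x_1, ..., x_n) is x : {ffun 'I_n -> 'I_d},
   where the paper's x_j is x at the ordinal of value j-1 (0-based storage).
   U l is the paper's d x d unitary U^(l) (only used for 2 <= l <= n). *)

(* Amplitude of |Psi'> on the basis vector
   |q~>_Q |r>_R |x_1>_{A_1} ... |x_n>_{A_n}, where the Q-basis used is the
   (orthonormal) basis {|x~_n>} measured by A_n: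
   <q~, r, x | Psi'> = d^{-1/2} [q = x_n] [r = x_1]
                       U^(2)_{x_1 x_2} ... U^(n)_{x_(n-1) x_n}. *)
Definition psi (d n : nat) (U : nat -> 'M[C]_d)
    (q r : 'I_d) (x : {ffun 'I_n -> 'I_d}) : C :=
  ((Num.sqrt (d%:R : R))%:C%C)^-1 *
  ([forall i : 'I_n, (val i == n.-1) ==> (x i == q)])%:R *
  ([forall i : 'I_n, (val i == 0%N) ==> (x i == r)])%:R *
  \prod_(i : 'I_n) \prod_(j : 'I_n | i.+1 == j) U j.+1 (x i) (x j).

(* Generic partial trace of |Psi'><Psi'| : trace out Q, R and every ancilla
   whose 0-based position does not satisfy [keep]; [proj x t] says that the
   full configuration x restricts, on the kept ancillae, to the basis label t
   of the kept subsystem (T indexes an orthonormal product basis of the kept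
   ancillae). *)
Definition reduced (d n : nat) (U : nat -> 'M[C]_d) (T : finType)
    (keep : pred nat) (proj : {ffun 'I_n -> 'I_d} -> T -> bool) :
    T -> T -> C :=
  fun t t' =>
    \sum_(q : 'I_d) \sum_(r : 'I_d) \sum_(x : {ffun 'I_n -> 'I_d})
      \sum_(x' : {ffun 'I_n -> 'I_d})
        (proj x t && proj x' t' &&
         [forall i : 'I_n, ~~ keep (val i) ==> (x i == x' i)])%:R *
        psi U q r x * conjC (psi U q r x').

Definition restr_blk (d n L : nat) (off : nat)
    (x : {ffun 'I_n -> 'I_d}) (y : {ffun 'I_L -> 'I_d}) : bool :=
  [forall t : 'I_L, forall i : 'I_n, (val i == off + val t) ==> (x i == y t)].

Definition at_pos (d L : nat) (w : {ffun 'I_L -> 'I_d}) (j : nat) (a : 'I_d)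
  : bool := [forall t : 'I_L, (val t == j) ==> (w t == a)].

(* rho(A_k A_(k+1) ... A_m), paper's 1-based k, m; basis labels of the block
   are y : {ffun 'I_(m-k+1) -> 'I_d}, y at position t being the label of
   A_(k+t). *)
Definition rho_block (d n : nat) (U : nat -> 'M[C]_d) (k m : nat) :
    {ffun 'I_(m - k).+1 -> 'I_d} -> {ffun 'I_(m - k).+1 -> 'I_d} -> C :=
  @reduced d n U _ (fun j => (k.-1 <= j <= m.-1)%N) (fun (x : {ffun 'I_n -> 'I_d}) y => restr_blk k.-1 x y).

Definition rho_pair (d n : nat) (U : nat -> 'M[C]_d) (k m : nat) :
    ('I_d * 'I_d) -> ('I_d * 'I_d) -> C :=
  @reduced d n U _ (fun j => (j == k.-1) || (j == m.-1))
    (fun x ab => [forall i : 'I_n, ((val i == k.-1) ==> (x i == ab.1)) &&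
                                   ((val i == m.-1) ==> (x i == ab.2))]).

(* p_{x_k x_m} = sum over x_(k+1..m-1) of
   |U^(k+1)_{x_k x_(k+1)}|^2 ... |U^(m)_{x_(m-1) x_m}|^2;
   w ranges over block configurations (w at t = x_(k+t)). *)
Definition pcoef (d : nat) (U : nat -> 'M[C]_d) (k m : nat) (a b : 'I_d) : C :=
  \sum_(w : {ffun 'I_(m - k).+1 -> 'I_d} |
          at_pos w 0 a && at_pos w (m - k) b)
    \prod_(t : 'I_(m - k).+1) \prod_(t' : 'I_(m - k).+1 | t.+1 == t')
       `|U (k + t') (w t) (w t')| ^+ 2.

(* Component on the block basis vector y of |a> (x) |phi> (x) |b>, where
   phi is a vector of the middle ancillae A_(k+1) ... A_(m-1), whose basis
   labels are z : {ffun 'I_(m-k-1) -> 'I_d} (z at s = label of A_(k+1+s)). *)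
Definition tensor3 (d k m : nat) (a b : 'I_d)
    (phi : {ffun 'I_(m - k).-1 -> 'I_d} -> C)
    (y : {ffun 'I_(m - k).+1 -> 'I_d}) : C :=
  \sum_(z : {ffun 'I_(m - k).-1 -> 'I_d})
    (at_pos y 0 a && at_pos y (m - k) b && restr_blk 1 y z)%:R * phi z.

Definition cq_state (d : nat) (U : nat -> 'M[C]_d) (k m : nat)
    (phi : 'I_d -> 'I_d -> {ffun 'I_(m - k).-1 -> 'I_d} -> C)
    (y y' : {ffun 'I_(m - k).+1 -> 'I_d}) : C :=
  (d%:R)^-1 * \sum_(a : 'I_d) \sum_(b : 'I_d)
    pcoef U k m a b * tensor3 a b (phi a b) y * conjC (tensor3 a b (phi a b) y').

Definition opmx (T : finType) (rho : T -> T -> C) : 'M[C]_#|T| :=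
  \matrix_(i, j) rho (enum_val i) (enum_val j).

(* Von Neumann entropy with logarithm base b:
   S(rho) = - sum_lambda lambda log_b lambda over the eigenvalues of rho
   (with multiplicity), given by the spectral decomposition of spectral.v
   (valid for normal, in particular Hermitian, matrices); 0 log 0 = 0. *)
Definition vN_entropy (b : nat) (T : finType) (rho : T -> T -> C) : R :=
  - \sum_(i < #|T|)
      (let l := complex.Re (spectral_diag (opmx rho) 0 i) in
       if l == 0 then 0 else l * (ln l / ln (b%:R))).

End QDefs.

(* Main.v *)
(** Tracing out the ancillae before A_k (with R) and after A_m (with Q) sums the
    chain of unitaries over equal bra and ket labels, so unitarity collapses both
    ends to Kronecker deltas and
    rho(y, y') = d^-1 [y_k = y'_k] [y_m = y'_m] W(y) W(y')^*,
    where W(y) is the product of the matrix entries inside the block.  Hence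
    rho(A_k...A_m) = G G^* for G(y, (a, b)) = d^(-1/2) [y_k = a] [y_m = b] W(y),
    while the marginal rho(A_k A_m) is G^* G; by Sylvester's determinant identity
    the two have the same spectrum up to zeros, hence the same entropy. *)

Require Import Defs.
From HB Require Import structures.
From mathcomp Require Import all_boot all_order all_algebra.
From mathcomp Require Import spectral.
From mathcomp Require Import complex.
From mathcomp Require Import zify ring.
From mathcomp Require Import all_classical all_reals exp.
Import Order.TTheory GRing.Theory Num.Theory Num.Def.
Local Open Scope ring_scope.

(** * Spectra of [A B] and [B A] *)

(** The block matrix [M] becomes block triangular when multiplied on the right by a matrix of
    determinant 1, and also on the left by one of determinant [x ^+ n]. Comparing determinants
    requires no inverse of [x]. *)
Lemma det_sub_mulmxC (K : comPzRingType) (m n : nat) (x : K)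
    (A : 'M[K]_(m, n)) (B : 'M[K]_(n, m)) :
  x ^+ n * \det (x%:M - A *m B) = x ^+ m * \det (x%:M - B *m A).
Proof.
pose M := block_mx x%:M A B 1%:M.
have e1 : M *m block_mx 1%:M 0 (- B) 1%:M = block_mx (x%:M - A *m B) A 0 1%:M.
  rewrite mulmx_block !mulmx1 !mulmx0 !mulmxN !mul1mx subrr add0r.
  by rewrite ?add0r.
have e2 : block_mx 1%:M 0 (- B) x%:M *m M = block_mx x%:M A 0 (x%:M - B *m A).
  rewrite mulmx_block !mulmx1 !mul1mx !mul0mx !addr0 !mulNmx.
  by rewrite mul_mx_scalar mul_scalar_mx addNr addrC.
move: (congr1 determinant e1) (congr1 determinant e2).
rewrite !det_mulmx !det_ublock !det_lblock !det1 !det_scalar !mulr1 !mul1r.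
by move=> ->.
Qed.

Lemma char_poly_mulmxC (K : comNzRingType) (m n : nat)
    (A : 'M[K]_(m, n)) (B : 'M[K]_(n, m)) :
  'X^n * char_poly (A *m B) = 'X^m * char_poly (B *m A).
Proof. by rewrite /char_poly /char_poly_mx !map_mxM det_sub_mulmxC. Qed.

(** In the spectral decomposition the inverse of the unitary factor is rotated to the other end by
    [char_poly_mulmxC]; the powers of ['X] agree and cancel, and a diagonal matrix is left. *)
Lemma char_poly_spectral (F : numClosedFieldType) (n : nat) (A : 'M[F]_n) :
  A \is normalmx ->
  char_poly A = \prod_(i < n) ('X - (spectral_diag A 0 i)%:P).
Proof.
move=> /orthomx_spectralP eA.
have Xn0 : 'X^n != 0 :> {poly F} by rewrite expf_neq0 ?polyX_eq0.
apply: (mulfI Xn0); rewrite {1}eA -mulmxA char_poly_mulmxC -mulmxA.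
rewrite mulmxV ?spectral_unit // mulmx1 char_poly_trig ?diag_mx_is_trig //.
by congr (_ * _); apply: eq_bigr => i _; rewrite mxE eqxx mulr1n.
Qed.

(** Padding the two spectra with [n] and [m] zeros respectively gives lists with the same product of
    linear factors, hence equal up to permutation. The condition [f 0 = 0] makes the padding
    harmless. *)
Lemma sum_spectral_mulmxC (F : numClosedFieldType) (V : nmodType) (m n : nat)
    (A : 'M[F]_(m, n)) (B : 'M[F]_(n, m)) (f : F -> V) :
  A *m B \is normalmx -> B *m A \is normalmx -> f 0 = 0 ->
  \sum_(i < m) f (spectral_diag (A *m B) 0 i) =
  \sum_(i < n) f (spectral_diag (B *m A) 0 i).
Proof.
move=> nAB nBA f0.
pose s p (D : 'rV[F]_p) q := [seq D 0 i | i <- enum 'I_p] ++ nseq q 0.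
have prod_s p (D : 'rV[F]_p) q :
    \prod_(x <- s p D q) ('X - x%:P) = 'X^q * \prod_(i < p) ('X - (D 0 i)%:P).
  rewrite big_cat big_map big_enum big_nseq subr0 mulrC /=.
  by rewrite -Monoid.iteropE.
have sum_s p (D : 'rV[F]_p) q :
    \sum_(x <- s p D q) f x = \sum_(i < p) f (D 0 i).
  rewrite big_cat big_map big_enum big_nseq f0 /=.
  by rewrite iter_addr_0 mul0rn addr0.
rewrite -(sum_s _ _ n) -(sum_s _ _ m); apply/perm_big/prod_XsubC_eq.
by rewrite !prod_s -!char_poly_spectral // char_poly_mulmxC.
Qed.

Lemma vN_entropy_mulmxC (R : realType) (b : nat) (S T : finType)
    (rho : S -> S -> R[i]) (sigma : T -> T -> R[i]) (G : S -> T -> R[i]) :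
  (forall y y', rho y y' = \sum_t G y t * conjC (G y' t)) ->
  (forall t t', sigma t t' = \sum_y conjC (G y t) * G y t') ->
  vN_entropy b rho = vN_entropy b sigma.
Proof.
move=> rhoE sigmaE.
pose A : 'M_(#|S|, #|T|) := \matrix_(i, j) G (enum_val i) (enum_val j).
have eRho : opmx rho = A *m (A ^t*)%sesqui.
  apply/matrixP => i j; rewrite !mxE rhoE (eq_bigl [in T]) // big_enum_val /=.
  by apply: eq_bigr => l _; rewrite !mxE.
have eSigma : opmx sigma = (A ^t*)%sesqui *m A.
  apply/matrixP => i j; rewrite !mxE sigmaE (eq_bigl [in S]) // big_enum_val /=.
  by apply: eq_bigr => l _; rewrite !mxE.
have conjKmx p q (M : 'M[R[i]]_(p, q)) : ((M ^t*) ^t*)%sesqui = M.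
  by apply/matrixP => i j; rewrite !mxE conjCK.
have conjM p q r (M : 'M[R[i]]_(p, q)) (N : 'M_(q, r)) :
    ((M *m N) ^t*)%sesqui = (N ^t*)%sesqui *m (M ^t*)%sesqui.
  by rewrite trmx_mul map_mxM.
congr (- _); rewrite eRho eSigma.
(* The convention for [0 log 0] is what makes the entropy summand vanish at 0; both products are
   Hermitian, hence normal. *)
apply: (@sum_spectral_mulmxC _ _ _ _ _ _ (fun z : R[i] => let l := complex.Re z in
  if l == 0 then 0 else l * (ln l / ln b%:R))) => /=; last by rewrite eqxx.
- by apply/normalmxP; rewrite conjM conjKmx.
- by apply/normalmxP; rewrite conjM conjKmx.
Qed.

(** * Sums over chains of labels *)

Lemma inord_max (n : nat) : inord n = ord_max :> 'I_n.+1.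
Proof. by apply: ord_inj; rewrite inordK. Qed.

Lemma inord0 (n : nat) : inord 0 = ord0 :> 'I_n.+1.
Proof. by apply: ord_inj; rewrite inordK. Qed.

Lemma prod_succ (K : comPzRingType) (n : nat) (F : 'I_n.+1 -> 'I_n.+1 -> K) :
  \prod_(i : 'I_n.+1) \prod_(j : 'I_n.+1 | i.+1 == j) F i j =
  \prod_(t < n) F (inord t) (inord t.+1).
Proof.
(* The last index has no successor, so its inner product is empty. *)
rewrite big_ord_recr /= [X in _ * X]big_pred0 ?mulr1; last first.
  by move=> j; rewrite gtn_eqF.
apply: eq_bigr => t _; rewrite (big_pred1 (inord t.+1)) => [|j].
  by congr F; apply: val_inj; rewrite /= inordK // ltnW ?ltnS.
by rewrite /= -val_eqE /= inordK ?ltnS // eq_sym.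
Qed.

Lemma sum_ffun_recr (V : nmodType) (P : finType) (n : nat)
    (F : {ffun 'I_n.+1 -> P} -> V) :
  \sum_x F x = \sum_(x : {ffun 'I_n -> P}) \sum_p
    F [ffun i => if unlift ord_max i is Some j then x j else p].
Proof.
rewrite pair_big /=.
rewrite (reindex_onto
  (fun xp : {ffun 'I_n -> P} * P =>
     [ffun i => if unlift ord_max i is Some j then xp.1 j else xp.2])
  (fun x => ([ffun j => x (lift ord_max j)], x ord_max))) /= => [|x _].
  apply: eq_bigl => -[x p] /=; rewrite xpair_eqE !ffunE unlift_none eqxx andbT.
  by apply: (introT eqP); apply/ffunP => j; rewrite !ffunE liftK.
by apply/ffunP => i; rewrite !ffunE; case: unliftP => [j|] -> //; rewrite ffunE.
Qed.

Section Transfer.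
Variables (K : comPzRingType) (P : finType) (v : P -> K) (M : nat -> P -> P -> K).

(** The transfer-matrix method: the row vector [v] multiplied by the first [n] matrices [M 0],
    [M 1], and so on, which gives the total weight of the [n]-step paths ending at a given label. *)
Fixpoint transfer (n : nat) : P -> K :=
  if n is n'.+1 then fun t => \sum_s transfer n' s * M n' s t else v.

(** Induction on [n] for all [w] at once: the last step of the path is absorbed into the final
    weight, which becomes [M n] applied to [w]. *)
Lemma sum_paths (n : nat) (w : P -> K) :
  \sum_(x : {ffun 'I_n.+1 -> P})
    v (x ord0) * (\prod_(t < n) M t (x (inord t)) (x (inord t.+1))) *
    w (x ord_max) = \sum_p transfer n p * w p.
Proof.
elim: n w => [|n IHn] w.
  rewrite (reindex_onto (fun p : P => [ffun _ : 'I_1 => p]) (fun x => x ord0)).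
    by apply: eq_big => [p|p _]; rewrite !ffunE ?eqxx // big_ord0 mulr1.
  by move=> x _; apply/ffunP => i; rewrite ffunE (ord1 i).
rewrite sum_ffun_recr /=.
under [RHS]eq_bigr => p _ do rewrite mulr_suml.
rewrite [RHS]exchange_big /=.
rewrite [RHS](eq_bigr (fun s => transfer n s * \sum_p M n s p * w p)); last first.
  by move=> s _; rewrite mulr_sumr; apply: eq_bigr => p _; rewrite mulrA.
rewrite -(IHn (fun s => \sum_p M n s p * w p));
  apply: eq_bigr => x _; rewrite mulr_sumr; apply: eq_bigr => p _.
have xE (t : nat) : (t < n.+1)%N ->
    unlift ord_max (inord t : 'I_n.+2) = Some (inord t).
  move=> lt_tn; rewrite (_ : inord t = lift ord_max (inord t)) ?liftK //.
  by apply: ord_inj; rewrite lift_max !inordK // ltnW.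
have x0 : unlift ord_max (ord0 : 'I_n.+2) = Some ord0.
  by rewrite -inord0 xE // inord0.
rewrite big_ord_recr /= !ffunE x0 unlift_none xE // !mulrA.
rewrite !inord_max unlift_none.
congr (_ * _ * _ * _). apply: eq_bigr => t _.
by rewrite !ffunE !xE // ltnS // ltnW.
Qed.

End Transfer.

(** Merges the ket and bra configurations into one path of label pairs, so that [sum_paths] applies
    to the double sum of a partial trace. *)
Lemma sum_pair_ffun (V : nmodType) (I P Q : finType)
    (F : {ffun I -> P} -> {ffun I -> Q} -> V) :
  \sum_x \sum_y F x y =
  \sum_(z : {ffun I -> P * Q}) F [ffun i => (z i).1] [ffun i => (z i).2].
Proof.
rewrite pair_big /= (reindex (fun z : {ffun I -> P * Q} =>
  ([ffun i => (z i).1], [ffun i => (z i).2]))) //=.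
exists (fun xy : {ffun I -> P} * {ffun I -> Q} => [ffun i => (xy.1 i, xy.2 i)]).
  by move=> z _; apply/ffunP => i; rewrite !ffunE /=; case: (z i).
by move=> [x y] _; apply/eqP; rewrite xpair_eqE; apply/andP; split;
  apply/eqP/ffunP => i; rewrite !ffunE.
Qed.

Lemma sum_unitary_row (C : numClosedFieldType) (d : nat) (U : 'M[C]_d)
    (s s' : 'I_d) :
  U \is unitarymx -> \sum_t U s t * conjC (U s' t) = (s == s')%:R.
Proof.
move=> /unitarymxP /matrixP /(_ s s'); rewrite !mxE => <-.
by apply: eq_bigr => t _; rewrite !mxE.
Qed.

Lemma sum_unitary_col (C : numClosedFieldType) (d : nat) (U : 'M[C]_d)
    (t t' : 'I_d) :
  U \is unitarymx -> \sum_s U s t * conjC (U s t') = (t == t')%:R.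
Proof.
rewrite -trmx_unitary => /(sum_unitary_row _ _ _ t t') <-.
by apply: eq_bigr => s _; rewrite !mxE.
Qed.

(** Turns a global constraint on a configuration into local factors that can be distributed over the
    steps of a path. *)
Lemma forall_natr (K : pzSemiRingType) (I : finType) (b : pred I) :
  ([forall i, b i])%:R = \prod_i (b i)%:R :> K.
Proof.
have -> : [forall i, b i] = \big[andb/true]_i b i by rewrite big_andE.
apply: (big_morph (fun c : bool => c%:R : K)) => // c c'.
by rewrite -mulnb natrM.
Qed.

(** * The reduced states *)

(** Positions count from 0 while the unitaries are numbered by the later ancilla counted from 1;
    hence the step leaving position [off + t] carries the index [(off + t).+2]. *)
Definition path_amp (R : realType) (d : nat) (U : nat -> 'M[R[i]]_d)
    (off L : nat) (y : {ffun 'I_L.+1 -> 'I_d}) : R[i] :=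
  \prod_(t < L) U (off + t).+2 (y (inord t)) (y (inord t.+1)).

Lemma forall_val_eq (n j : nat) (b : pred 'I_n.+1) : (j <= n)%N ->
  [forall i : 'I_n.+1, (val i == j) ==> b i] = b (inord j).
Proof.
move=> le_jn; apply/forallP/idP => [/(_ (inord j)) | bj i].
  by rewrite /= inordK // eqxx.
by apply/implyP => /eqP ij; move: bj; rewrite -ij inord_val.
Qed.

Lemma psiE (R : realType) (d n : nat) (U : nat -> 'M[R[i]]_d) (q r : 'I_d)
    (x : {ffun 'I_n.+1 -> 'I_d}) :
  psi U q r x = ((Num.sqrt (d%:R : R))%:C%C)^-1 * (x ord_max == q)%:R *
    (x ord0 == r)%:R * path_amp _ _ U 0 _ x.
Proof.
rewrite /psi !forall_val_eq // inord_max inord0 prod_succ; congr (_ * _).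
by apply: eq_bigr => t _; rewrite inordK ?ltnS.
Qed.

Lemma sum_delta (K : pzRingType) (T : finType) (a b : T) :
  \sum_t (a == t)%:R * (b == t)%:R = (a == b)%:R :> K.
Proof.
rewrite (bigD1 b) //= eqxx mulr1 big1 ?addr0 // => t /negbTE.
by rewrite eq_sym => ->; rewrite mulr0.
Qed.

(** [Q] and [R] enter [psi] only through deltas on the last and first labels, so tracing them out
    equates these labels in ket and bra; the two normalizations multiply to [d%:R^-1]. *)
Lemma reducedE (R : realType) (d n : nat) (U : nat -> 'M[R[i]]_d) (T : finType)
    (keep : pred nat) (proj : {ffun 'I_n.+1 -> 'I_d} -> T -> bool) (t t' : T) :
  reduced U keep proj t t' = d%:R^-1 * \sum_x \sum_x'
    (proj x t && proj x' t' &&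
       [forall i : 'I_n.+1, ~~ keep (val i) ==> (x i == x' i)])%:R *
    ((x ord0 == x' ord0)%:R * (x ord_max == x' ord_max)%:R *
     (path_amp _ _ U 0 _ x * conjC (path_amp _ _ U 0 _ x'))).
Proof.
rewrite /reduced.
under eq_bigr => q _ do rewrite exchange_big.
rewrite exchange_big mulr_sumr; apply: eq_bigr => x _ /=.
under eq_bigr => q _ do rewrite exchange_big.
rewrite exchange_big mulr_sumr; apply: eq_bigr => x' _ /=.
set B := (_ && _)%:R; set W := path_amp _ _ _ _ _ _; set W' := path_amp _ _ _ _ _ _.
pose c : R[i] := ((Num.sqrt (d%:R : R))%:C%C)^-1.
have c_real : conjC c = c.
  by apply: geC0_conj; rewrite invr_ge0 ler0c sqrtr_ge0.
have cc : c * c = d%:R^-1.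
  rewrite -invfM -rmorphM /= -expr2 sqr_sqrtr ?ler0n //.
  by rewrite rmorph_nat.
(* The two equalities of end labels are expanded back into sums over [r] and [q], to compare term by
   term. *)
rewrite -(sum_delta _ _ (x ord0) (x' ord0)) -(sum_delta _ _ (x ord_max)) -cc.
rewrite [in RHS]mulrC -!mulrA mulr_suml !mulr_sumr exchange_big.
apply: eq_bigr => r _ /=; rewrite !(mulr_suml, mulr_sumr); apply: eq_bigr => q _.
rewrite !psiE -/c !rmorphM !rmorph_nat /= c_real -/W -/W'; ring.
Qed.

Lemma sum_pair (V : nmodType) (P Q : finType) (F : P * Q -> V) :
  \sum_p F p = \sum_s \sum_t F (s, t).
Proof. by rewrite pair_big; apply: eq_bigr => -[]. Qed.

(** * Partial trace onto a block of consecutive ancillae *)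

Section BlockState.
Variables (R : realType) (d n : nat) (U : nat -> 'M[R[i]]_d).
Hypothesis unitaryU : forall l, (2 <= l <= n.+1)%N -> U l \is unitarymx.
Variables (off L : nat).
Hypothesis le_off : (off + L <= n)%N.
Variables y y' : {ffun 'I_L.+1 -> 'I_d}.

Let agree (i : nat) (p : 'I_d * 'I_d) : bool :=
  if (off <= i <= off + L)%N
  then (p.1 == y (inord (i - off))) && (p.2 == y' (inord (i - off)))
  else p.1 == p.2.

(** The second factor is the trace over [R], which carries the label of the first ancilla. *)
Let v (p : 'I_d * 'I_d) : R[i] := (agree 0 p)%:R * (p.1 == p.2)%:R.

Let M (i : nat) (p q : 'I_d * 'I_d) : R[i] :=
  U i.+2 p.1 q.1 * conjC (U i.+2 p.2 q.2) * (agree i.+1 q)%:R.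

Let Z := transfer _ _ v M.

(* [Z] is the transfer recursion on pairs (ket label, bra label): position by
   position, [agree] forces the two labels to be equal outside the block and to
   be [y], [y'] inside it. *)
Lemma restr_blk_agree (x x' : {ffun 'I_n.+1 -> 'I_d}) :
  restr_blk off x y && restr_blk off x' y' &&
    [forall i : 'I_n.+1, ~~ (off <= val i <= off + L)%N ==> (x i == x' i)] =
  [forall i : 'I_n.+1, agree i (x i, x' i)].
Proof.
apply/andP/forallP => [[/andP[/forallP rx /forallP rx'] /forallP xx'] i|ag].
  rewrite /agree; case: ifP => [/andP[le_oi le_io]|/negbT out] /=; last first.
    by have /implyP := xx' i; apply.
  have lt_i : (i - off < L.+1)%N by lia.
  have i_t : val i == (off + val (inord (i - off) : 'I_L.+1))%N.
    by rewrite /= inordK // subnKC.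
  have /forallP/(_ i)/implyP/(_ i_t) -> := rx (inord (i - off)).
  by have /forallP/(_ i)/implyP/(_ i_t) -> := rx' (inord (i - off)).
have in_blk (i : 'I_n.+1) (t : 'I_L.+1) : val i == (off + val t)%N ->
    (x i == y t) && (x' i == y' t).
  move=> /eqP /= i_t; have := ag i; rewrite /agree i_t leq_addr leq_add2l.
  by rewrite -ltnS ltn_ord /= addKn inord_val.
split; [apply/andP; split|].
- apply/forallP => t; apply/forallP => i; apply/implyP.
  by move=> /in_blk /andP[].
- apply/forallP => t; apply/forallP => i; apply/implyP.
  by move=> /in_blk /andP[].
- apply/forallP => i; apply/implyP => /negbTE out.
  by have := ag i; rewrite /agree out.
Qed.

(** The delta created by the trace over [R] travels forward: before the block ket and bra share a
    label, and summing over it leaves a delta on the next pair by orthonormality of the columns. *)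
Lemma transfer_prefix (i : nat) (p : 'I_d * 'I_d) : (i <= off)%N ->
  Z i p = (p.1 == p.2)%:R * (agree i p)%:R.
Proof.
elim: i p => [|i IHi] p lt_io; first by rewrite mulrC.
rewrite /Z /= -/(Z i).
rewrite sum_pair.
rewrite -(sum_unitary_col _ _ (U i.+2)); last by apply: unitaryU; lia.
rewrite mulr_suml; apply: eq_bigr => s _.
rewrite (bigD1 s) //= big1 ?addr0 => [|s' ne_s].
  rewrite IHi 1?ltnW //= eqxx /agree leqNgt lt_io /= eqxx !mul1r.
  by rewrite /M.
by rewrite IHi 1?ltnW //= eq_sym (negbTE ne_s) !mul0r.
Qed.

(** Inside the block [agree] admits a single pair at each position, so every sum has one surviving
    term and the matrix entries accumulate. The delta on [y ord0] is inherited from the prefix. *)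
Lemma transfer_block (t : nat) (p : 'I_d * 'I_d) : (t <= L)%N ->
  Z (off + t) p = (y ord0 == y' ord0)%:R * (agree (off + t) p)%:R *
    \prod_(j < t) (U (off + j).+2 (y (inord j)) (y (inord j.+1)) *
      conjC (U (off + j).+2 (y' (inord j)) (y' (inord j.+1)))).
Proof.
have agreeE i q : (i <= L)%N ->
    agree (off + i) q = (q == (y (inord i), y' (inord i))).
  move=> le_iL; rewrite /agree leq_addr leq_add2l le_iL addKn /=.
  by case: q.
elim: t p => [|t IHt] p lt_tL.
  rewrite transfer_prefix ?addn0 // big_ord0 mulr1.
  have := agreeE 0%N p isT; rewrite addn0 => ->.
  by case: (p =P _) => [->|_]; rewrite ?mulr0 //= inord0.
rewrite addnS /Z /= -/(Z (off + t)).
rewrite (bigD1 (y (inord t), y' (inord t))) //= big1 ?addr0 => [|q ne_q].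
  rewrite IHt 1?ltnW // agreeE 1?ltnW // eqxx mulr1 big_ord_recr /= /M /=.
  rewrite -addnS agreeE //; case: (p =P _) => [->|_] /=; last first.
    by rewrite !(mulr0, mul0r).
  by rewrite !mulr1 !mulrA.
by rewrite IHt 1?ltnW // agreeE 1?ltnW // (negbTE ne_q) !(mulr0, mul0r).
Qed.

(** Mirror image of the prefix: the final delta, due to the trace over [Q], travels backward by
    orthonormality of the rows. *)
Lemma transfer_suffix (i : nat) : (off + L + i <= n)%N ->
  \sum_p Z (off + L + i) p * (p.1 == p.2)%:R =
  \sum_p Z (off + L) p * (p.1 == p.2)%:R.
Proof.
elim: i => [|i IHi] lt_in; first by rewrite addn0.
rewrite -IHi; last by lia.
rewrite addnS /Z /= -/(Z (off + L + i)).
under eq_bigr => p _ do rewrite mulr_suml.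
rewrite exchange_big; apply: eq_bigr => q _ /=.
rewrite -(sum_unitary_row _ _ (U (off + L + i).+2)); last by apply: unitaryU; lia.
rewrite mulr_sumr sum_pair /=.
apply: eq_bigr => s _; rewrite (bigD1 s) //= big1 ?addr0 => [|s' ne_s].
  by rewrite eqxx mulr1 /M /agree ltnNge leq_addr /= andbF /= eqxx mulr1.
by rewrite eq_sym (negbTE ne_s) mulr0.
Qed.

Lemma reduced_blockE :
  reduced U (fun j => off <= j <= off + L)%N
    (fun (x : {ffun 'I_n.+1 -> 'I_d}) z => restr_blk off x z) y y' =
  d%:R^-1 * ((y ord0 == y' ord0)%:R * (y ord_max == y' ord_max)%:R *
    (path_amp _ _ U off _ y * conjC (path_amp _ _ U off _ y'))).
Proof.
rewrite reducedE; congr (_ * _); rewrite sum_pair_ffun.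
transitivity (\sum_p Z n p * (p.1 == p.2)%:R).
  rewrite -sum_paths; apply: eq_bigr => z _.
  pose x := [ffun i => (z i).1]; pose x' := [ffun i => (z i).2].
  rewrite -/x -/x' restr_blk_agree forall_natr.
  (* The constraint at position 0 belongs to [v], the one at position [t.+1] to step [t] of [M]. *)
  have -> : \prod_(i < n.+1) (agree i (x i, x' i))%:R = (agree 0 (z ord0))%:R *
      \prod_(t < n) (agree t.+1 (z (inord t.+1)))%:R :> R[i].
    rewrite big_ord_recl !ffunE -surjective_pairing; congr (_ * _).
    apply: eq_bigr => t _; rewrite !ffunE (_ : lift ord0 t = inord t.+1).
      by rewrite -surjective_pairing inordK ?ltnS.
    by apply: ord_inj; rewrite inordK ?ltnS.
  have -> : \prod_(t < n) M t (z (inord t)) (z (inord t.+1)) =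
      path_amp _ _ U 0 _ x * conjC (path_amp _ _ U 0 _ x') *
      \prod_(t < n) (agree t.+1 (z (inord t.+1)))%:R.
    rewrite /M !big_split /path_amp rmorph_prod /=.
    by congr (_ * _ * _); apply: eq_bigr => t _; rewrite !ffunE.
  by rewrite /v !ffunE; ring.
(* The sum is moved back from position [n] to the end of the block, where only the pair of last
   labels of [y] and [y'] contributes. *)
rewrite -[in LHS](subnKC le_off) transfer_suffix ?subnKC //.
rewrite (bigD1 (y ord_max, y' ord_max)) //= big1 ?addr0 => [|p ne_p].
  rewrite transfer_block // /agree leq_addr leqnn /= addKn inord_max !eqxx.
  by rewrite big_split /= -rmorph_prod mulr1 -/(path_amp _ _ U off _ y); ring.
rewrite transfer_block // /agree leq_addr leqnn /= addKn inord_max.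
case: p ne_p => a b; rewrite xpair_eqE /= => /negbTE ->.
by rewrite !(mulr0, mul0r).
Qed.
End BlockState.

(** * Splitting block labels into first, middle and last *)

Definition window (d n off L : nat) (x : {ffun 'I_n.+1 -> 'I_d}) :
    {ffun 'I_L -> 'I_d} :=
  [ffun t : 'I_L => x (inord (off + t))].

Lemma restr_blkE (d n off L : nat) (x : {ffun 'I_n.+1 -> 'I_d})
    (y : {ffun 'I_L -> 'I_d}) : (off + L <= n.+1)%N ->
  restr_blk off x y = (y == window d n off L x).
Proof.
move=> le_off.
have lt_t (t : 'I_L) : (off + t <= n)%N by have := ltn_ord t; lia.
have restrE t : [forall i : 'I_n.+1, (val i == off + val t)%N ==> (x i == y t)] =
    (x (inord (off + t)) == y t).
  exact: (forall_val_eq n (off + t) (fun i => x i == y t)).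
apply/forallP/eqP => [xy|y_x t]; last first.
  by apply: etrans (restrE t) _; rewrite y_x ffunE eqxx.
apply/ffunP => t; rewrite ffunE; apply/esym/eqP.
exact: etrans (esym (restrE t)) (xy t).
Qed.

Lemma at_pos0 (d L : nat) (y : {ffun 'I_L.+1 -> 'I_d}) (a : 'I_d) :
  at_pos y 0 a = (y ord0 == a).
Proof. by rewrite /at_pos (forall_val_eq L _ (fun i => y i == _)) // inord0. Qed.

Lemma at_pos_max (d L : nat) (y : {ffun 'I_L.+1 -> 'I_d}) (a : 'I_d) :
  at_pos y L a = (y ord_max == a).
Proof. by rewrite /at_pos (forall_val_eq L _ (fun i => y i == _)) // inord_max. Qed.

(** At a nonzero position [t], [insub t.-1] fails exactly when [t] is the last position [L]; this is
    where [b] is placed. *)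
Definition glue (d L : nat) (a b : 'I_d) (z : {ffun 'I_L.-1 -> 'I_d}) :
    {ffun 'I_L.+1 -> 'I_d} :=
  [ffun t : 'I_L.+1 => if t == ord0 then a
                       else if insub t.-1 is Some s then z s else b].

(** Positivity of [L] keeps the first and last positions distinct, so the two end labels can be
    prescribed independently. *)
Lemma eq_glue (d L : nat) (a b : 'I_d) (z : {ffun 'I_L.-1 -> 'I_d})
    (y : {ffun 'I_L.+1 -> 'I_d}) : (0 < L)%N ->
  (y == glue d L a b z) =
  [&& y ord0 == a, y ord_max == b & z == window d L 1 L.-1 y].
Proof.
move=> L_gt0; apply/eqP/and3P => [->|[/eqP y0 /eqP yL /eqP ->]].
  split; first by rewrite ffunE.
    have max_neq0 : ord_max != ord0 :> 'I_L.+1.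
      by apply: contraTneq L_gt0 => /(congr1 val) /= ->.
    by rewrite ffunE (negbTE max_neq0) insubN ?ltnn.
  apply/eqP/ffunP => s; have lt_s := ltn_ord s.
  have lt_sL : (1 + s < L.+1)%N by lia.
  by rewrite !ffunE -val_eqE /= inordK // valK.
apply/ffunP => t; rewrite ffunE; case: eqP => [->//|/eqP t_neq0].
have t_gt0 : (0 < t)%N by rewrite lt0n.
case: insubP => [s _ s_t|]; rewrite ?ffunE.
  by congr (y _); apply: ord_inj; rewrite s_t add1n prednK // inordK.
rewrite -leqNgt => le_Lt; rewrite -yL; congr (y _); apply: ord_inj => /=.
by have := ltn_ord t; lia.
Qed.

(** * The block state, its two-end marginal and the classical-quantum form *)

Section Ancillae.
Variables (R : realType) (d n : nat) (U : nat -> 'M[R[i]]_d).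
Hypothesis unitaryU : forall l, (2 <= l <= n.+1)%N -> U l \is unitarymx.
Variables k m : nat.
Hypotheses (k_gt0 : (0 < k)%N) (lt_km : (k < m)%N) (le_mn : (m <= n.+1)%N).

Let L := (m - k)%N.
Let W : {ffun 'I_L.+1 -> 'I_d} -> R[i] := path_amp R d U k.-1 L.
Let ends (y : {ffun 'I_L.+1 -> 'I_d}) (t : 'I_d * 'I_d) : bool :=
  (y ord0 == t.1) && (y ord_max == t.2).

Lemma rho_blockE (y y' : {ffun 'I_L.+1 -> 'I_d}) :
  @rho_block R d n.+1 U k m y y' =
  d%:R^-1 * (((y ord0 == y' ord0)%:R * (y ord_max == y' ord_max)%:R) *
    (W y * conjC (W y'))).
Proof.
rewrite /rho_block (_ : m.-1 = k.-1 + L)%N; last by rewrite /L; lia.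
by apply: reduced_blockE => //; rewrite /L; lia.
Qed.

(** A partial trace may be taken in two stages, here first onto the block and then over its middle
    ancillae. *)
Lemma rho_pair_marginal (t t' : 'I_d * 'I_d) :
  @rho_pair R d n.+1 U k m t t' = \sum_y \sum_y'
    (ends y t && ends y' t' &&
     [forall s : 'I_L.+1, (0 < s < L)%N ==> (y s == y' s)])%:R *
    @rho_block R d n.+1 U k m y y'.
Proof.
rewrite /rho_pair /rho_block.
under [RHS]eq_bigr => y _ do
  under eq_bigr => y' _ do rewrite reducedE !mulr_sumr.
rewrite reducedE mulr_sumr.
under [RHS]eq_bigr => y _ do rewrite exchange_big.
rewrite [RHS]exchange_big; apply: eq_bigr => x _ /=.
under [RHS]eq_bigr => y _ do under eq_bigr => y' _ do rewrite !mulr_sumr.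
under [RHS]eq_bigr => y _ do rewrite exchange_big.
rewrite [RHS]exchange_big mulr_sumr; apply: eq_bigr => x' _ /=.
have le_blk : (k.-1 + L.+1 <= n.+1)%N by rewrite /L; lia.
(* Each full configuration restricts to exactly one block label, its window, so the sums over [y]
   and [y'] reduce to one term. *)
rewrite (bigD1 (window _ _ k.-1 L.+1 x)) //= [X in _ + X]big1 => [|y ne_y];
  last first.
  apply: big1 => y' _.
  by rewrite (restr_blkE _ _ _ _ x) // (negbTE ne_y) mul0r !mulr0.
rewrite addr0 (bigD1 (window _ _ k.-1 L.+1 x')) //= [X in _ + X]big1 => [|y ne_y];
  last first.
  by rewrite (restr_blkE _ _ _ _ x') // (negbTE ne_y) andbF mul0r !mulr0.
rewrite addr0 !restr_blkE // !eqxx /= [RHS]mulrCA; congr (_ * _).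
rewrite [RHS]mulrA; congr (_ * _); rewrite -natrM mulnb.
congr (nat_of_bool _)%:R.
have pairE (z : {ffun 'I_n.+1 -> 'I_d}) u :
    [forall i : 'I_n.+1, ((val i == k.-1) ==> (z i == u.1)) &&
                         ((val i == m.-1) ==> (z i == u.2))] =
    ends (window _ _ k.-1 L.+1 z) u.
  rewrite /ends !ffunE addn0 (_ : k.-1 + _ = m.-1)%N; last by rewrite /= /L; lia.
  rewrite -(forall_val_eq n k.-1 (fun i => z i == u.1)); last by lia.
  rewrite -(forall_val_eq n m.-1 (fun i => z i == u.2)); last by lia.
  apply/forallP/andP => [zu|[/forallP z1 /forallP z2] i]; last by rewrite z1 z2.
  by split; apply/forallP => i; case/andP: (zu i).
rewrite !pairE -[RHS]andbA; congr (_ && _).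
(* The positions traced out for the pair are those strictly inside the block together with those
   outside it. *)
apply/forallP/andP => [xx'|[/forallP inner /forallP outer] i].
  split; apply/forallP => i; apply/implyP => Hi.
    have lt_i := ltn_ord i; have lt_in : (k.-1 + i < n.+1)%N by lia.
    rewrite !ffunE; have /implyP -> // := xx' (inord (k.-1 + i)).
    by rewrite /= inordK //; move: Hi; rewrite /L; lia.
  by have /implyP -> // := xx' i; move: Hi; lia.
apply/implyP => Hi; case: (boolP (k.-1 <= i <= m.-1)%N) => [in_blk|out]; last first.
  by have /implyP -> := outer i.
have lt_i : (i - k.-1 < L.+1)%N by rewrite /L; lia.
have /implyP := inner (inord (i - k.-1)); rewrite !ffunE inordK // subnKC;
  last by lia.
by rewrite inord_val; apply; move: Hi; rewrite /L /=; lia.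
Qed.

(** The block state forces equal end labels and the trace forces equal middle labels, so only the
    terms with [y' = y] survive. *)
Lemma rho_pairE (t t' : 'I_d * 'I_d) :
  @rho_pair R d n.+1 U k m t t' =
  \sum_y (ends y t && ends y t')%:R * (d%:R^-1 * (W y * conjC (W y))).
Proof.
rewrite rho_pair_marginal; apply: eq_bigr => y _.
rewrite (bigD1 y) //= big1 ?addr0 => [|y' ne_y].
  have -> : [forall s : 'I_L.+1, (0 < s < L)%N ==> (y s == y s)].
    by apply/forallP => s; rewrite eqxx implybT.
  by rewrite rho_blockE !eqxx !mul1r andbT.
rewrite rho_blockE.
case: forallP => [inner|_]; last by rewrite andbF mul0r.
have [y0|_] := eqVneq (y ord0); last by rewrite !(mul0r, mulr0).
have [yL|_] := eqVneq (y ord_max); last by rewrite !(mul0r, mulr0).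
case/eqP: ne_y; apply/ffunP => s.
have := inner s; have := ltn_ord s.
have [->|s_neq0] := eqVneq s ord0; first by rewrite y0.
have [->|s_neqL] := eqVneq s ord_max; first by rewrite yL.
move: s_neq0 s_neqL; rewrite -!val_eqE /= => s0 sL lt_s.
move=> /implyP ys; apply/esym/eqP/ys; lia.
Qed.

Lemma entropy_block_pair (b : nat) :
  vN_entropy b (@rho_block R d n.+1 U k m) =
  vN_entropy b (@rho_pair R d n.+1 U k m).
Proof.
pose c : R[i] := sqrtC d%:R^-1.
have c_ge0 : 0 <= c by rewrite sqrtC_ge0 invr_ge0 ler0n.
have c_real : conjC c = c by apply: geC0_conj.
have cc : c * c = d%:R^-1 by rewrite -expr2 sqrtCK.
apply: (vN_entropy_mulmxC _ _ _ _ _ _ (fun y t => (ends y t)%:R * (c * W y))).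
  move=> y y'; rewrite rho_blockE sum_pair /= -cc.
  rewrite -(sum_delta _ _ (y ord0)) -(sum_delta _ _ (y ord_max)).
  rewrite [in LHS]mulrC -!mulrA !mulr_suml; apply: eq_bigr => a _.
  rewrite !(mulr_suml, mulr_sumr); apply: eq_bigr => e _.
  by rewrite !rmorphM !rmorph_nat /= c_real /ends -!mulnb !natrM; ring.
move=> t t'; rewrite rho_pairE; apply: eq_bigr => y _.
by rewrite !rmorphM !rmorph_nat /= c_real -cc -!mulnb !natrM; ring.
Qed.

Lemma pcoefE (a b : 'I_d) :
  pcoef U k m a b = \sum_(y | ends y (a, b)) `|W y| ^+ 2.
Proof.
rewrite /pcoef; apply: eq_big => [y|y _]; first by rewrite at_pos0 at_pos_max.
rewrite prod_succ /W /path_amp normr_prod -prodrXl; apply: eq_bigr => t _.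
rewrite inordK ?ltnS //; congr (`|U _ _ _| ^+ 2).
(* Positivity of [k] identifies [k + t.+1] with the index [(k.-1 + t).+2] of [path_amp]. *)
by rewrite -[LHS]/(k + t.+1)%N addnS -{1}(prednK k_gt0).
Qed.

Lemma pcoef_ge0 (a b : 'I_d) : 0 <= pcoef U k m a b.
Proof. by rewrite pcoefE sumr_ge0 // => y _; rewrite exprn_ge0. Qed.

(* When [p_ab = 0] the state [phi_ab] is arbitrary: any basis vector will do. *)
Definition mid_state (a b : 'I_d) (z : {ffun 'I_L.-1 -> 'I_d}) : R[i] :=
  if pcoef U k m a b == 0 then (z == [ffun => a])%:R
  else W (glue d L a b z) / sqrtC (pcoef U k m a b).

(** For fixed ends, [glue] is a bijection from middle labels to block labels with these ends, so the
    squared moduli of [W] add up to [pcoef]. *)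
Lemma mid_state_norm (a b : 'I_d) : \sum_z `|mid_state a b z| ^+ 2 = 1.
Proof.
have L_gt0 : (0 < L)%N by rewrite subn_gt0.
rewrite /mid_state; have [_|p_neq0] := eqVneq.
  rewrite (bigD1 [ffun => a]) //= eqxx normr1 expr1n big1 ?addr0 // => z.
  by move=> /negbTE ->; rewrite normr0 expr0n.
have p_ge0 := pcoef_ge0 a b.
under eq_bigr => z _.
  rewrite normrM exprMn normfV exprVn (ger0_norm (x := sqrtC _)) ?sqrtC_ge0 //.
  rewrite sqrtCK; over.
rewrite -mulr_suml [X in X / _](_ : _ = pcoef U k m a b) ?divff //.
rewrite pcoefE (reindex_onto (glue d L a b) (window d L 1 L.-1)) /=.
  apply: eq_bigl => z; have := eqxx (glue d L a b z).
  by rewrite {1}eq_glue // => /and3P[g0 gL /eqP <-]; rewrite /ends g0 gL eqxx.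
by move=> y /andP[y0 yL]; apply/esym/eqP; rewrite eq_glue // y0 yL eqxx.
Qed.

(** Keeping the factor [sqrtC] of the probability on the left makes the identity valid for zero
    probability too. *)
Lemma tensor3_mid_state (a b : 'I_d) (y : {ffun 'I_L.+1 -> 'I_d}) :
  sqrtC (pcoef U k m a b) * tensor3 a b (mid_state a b) y =
  (ends y (a, b))%:R * W y.
Proof.
have L_gt0 : (0 < L)%N by rewrite subn_gt0.
rewrite /tensor3 (bigD1 (window d L 1 L.-1 y)) //= [X in _ + X]big1 => [|z ne_z].
  rewrite addr0 at_pos0 at_pos_max restr_blkE ?eqxx ?andbT; last by lia.
  rewrite -/(ends y (a, b)); case: (boolP (ends y (a, b))) => [yab|_]; last first.
    by rewrite !(mul0r, mulr0).
  rewrite !mul1r /mid_state; have [p0|p_neq0] := eqVneq.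
    (* A vanishing sum of nonnegative terms forces each [W y] with these ends to vanish. *)
    rewrite p0 sqrtC0 mul0r; apply/esym/eqP; rewrite -normr_eq0.
    move/eqP: p0; rewrite pcoefE psumr_eq0 => [|z _]; last exact: exprn_ge0.
    by move=> /allP/(_ y (mem_index_enum _)); rewrite yab /= expf_eq0.
  rewrite mulrC divfK ?sqrtC_eq0 //; congr W; apply/esym/eqP.
  by case/andP: yab => y0 yL; rewrite eq_glue // y0 yL eqxx.
by rewrite restr_blkE ?(negbTE ne_z) ?andbF ?mul0r //; lia.
Qed.

Lemma rho_block_cq (y y' : {ffun 'I_L.+1 -> 'I_d}) :
  @rho_block R d n.+1 U k m y y' = cq_state U mid_state y y'.
Proof.
rewrite rho_blockE /cq_state; congr (_ * _).
rewrite -(sum_delta _ _ (y ord0)) -(sum_delta _ _ (y ord_max)).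
rewrite -!mulrA !mulr_suml; apply: eq_bigr => a _.
rewrite !(mulr_suml, mulr_sumr); apply: eq_bigr => b _.
have sqrt_real : conjC (sqrtC (pcoef U k m a b)) = sqrtC (pcoef U k m a b).
  by apply: geC0_conj; rewrite sqrtC_ge0 pcoef_ge0.
(* The probability is split into a square root for the ket and its conjugate for the bra, each
   absorbed by [tensor3_mid_state]. *)
rewrite -[in RHS](sqrtCK (pcoef U k m a b)) expr2 -{2}sqrt_real.
transitivity ((sqrtC (pcoef U k m a b) * tensor3 a b (mid_state a b) y) *
  conjC (sqrtC (pcoef U k m a b) * tensor3 a b (mid_state a b) y')).
  rewrite !tensor3_mid_state !rmorphM !rmorph_nat /= /ends -!mulnb !natrM /=.
  by ring.
by rewrite rmorphM /=; ring.
Qed.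

End Ancillae.

Theorem theorem2 (R : realType) (d n : nat) (U : nat -> 'M[R[i]]_d) :
  (2 <= d)%N -> (3 <= n)%N ->
  (forall l : nat, (2 <= l <= n)%N -> U l \is unitarymx) ->
  forall k m : nat, (1 <= k)%N -> (k < m)%N -> (m <= n)%N -> (2 <= m - k)%N ->
  (exists phi : 'I_d -> 'I_d -> {ffun 'I_(m - k).-1 -> 'I_d} -> R[i],
      (forall a b : 'I_d, \sum_(z : {ffun 'I_(m - k).-1 -> 'I_d})
                             `|phi a b z| ^+ 2 = 1) /\
      (forall y y' : {ffun 'I_(m - k).+1 -> 'I_d},
         @rho_block R d n U k m y y' = @cq_state R d U k m phi y y')) /\
  vN_entropy d (@rho_block R d n U k m) = vN_entropy d (@rho_pair R d n U k m).
Proof.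
case: n => [//|n] _ _ unitaryU k m k_gt0 lt_km le_mn _.
split; last exact: entropy_block_pair.
exists (mid_state R d U k m); split; first exact: mid_state_norm.
exact: (rho_block_cq _ _ n).
Qed.
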